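(* Let $X$ be baseline covariates, $A\in\{0,1\}$ an exposure, $M\in\{0,1\}$ a mediator, $Y$ a real-valued outcome, $S_M\in\{0,1\}$ an observed baseline variable, with potential outcomes $M(a)$, $Y(a,m)$, $Y(a)=Y(a,M(a))$. Suppose: (1) Consistency: if $A=a$ then $M=M(a)$; if additionally $M=m$ then $Y=Y(a,m)$. (2) Positivity: $P(A=a\mid X=x)>0$ and $P(M=m\mid A=a,X=x)>0$ for all $a,m\in\{0,1\}$ and almost every $x$. (3) For all $a,m$: $\{Y(a,m),M(a)\}\perp A\mid X$ and $Y(a,m)\perp M\mid A=a,X$. (4) Necessity: $P(M(b)=1\mid S_M=0,X)=0$ for each $b\in\{0,1\}$; and sufficiency-under-control: $P(M(0)=1\mid S_M=1,X)=1$. (5) $S_M\perp A\mid X$. (6) For all $a,m$: $\{Y(a,m),M(a)\}\perp A\mid X,S_M$ and $Y(a,m)\perp M\mid A=a,X,S_M$. (7) $Y\perp S_M\mid A,M,X$. Write $p_{ma}(x)=P(M=m\mid A=a,X=x)$, $\mu_{ma}(x)=\mathbb{E}[Y\mid M=m,A=a,X=x]$, and $\mu_{m,a,s}(x)=\mathbb{E}[Y\mid M=m,A=a,S_M=s,X=x]$. Then for almost every $x$: (a) $P(M(1)=1,M(0)=1\mid X=x)=p_{11}(x)$, $P(M(1)=0,M(0)=0\mid X=x)=p_{00}(x)$, $P(M(1)=0,M(0)=1\mid X=x)=p_{10}(x)-p_{11}(x)$. (b) $\mathbb{E}[Y(1)\mid M(1)=1,M(0)=1,X=x]=\mu_{11}(x)$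 and $\mathbb{E}[Y(0)\mid M(1)=0,M(0)=0,X=x]=\mu_{00}(x)$. (c) $\mathbb{E}[Y(1)\mid M(1)=0,M(0)=0,X=x]=\mu_{0,1,0}(x)=\mu_{01}(x)$ and $\mathbb{E}[Y(1)\mid M(1)=0,M(0)=1,X=x]=\mu_{0,1,1}(x)=\mu_{01}(x)$. (d) If $p_{10}(x)-p_{11}(x)>0$, then $$\mathbb{E}[Y(0)\mid M(1)=0,M(0)=1,X=x]=\frac{p_{10}(x)\mu_{10}(x)-p_{11}(x)\,\mathbb{E}[Y(0)\mid M(1)=1,M(0)=1,X=x]}{p_{10}(x)-p_{11}(x)}.$$ (e) Suppose in addition that for all $x$, $\mathbb{E}[Y(0,1)\mid M(1)=1,M(0)=1,X=x]=\mathbb{E}[Y(1,1)\mid M(1)=1,M(0)=1,X=x]$. Then $\mathbb{E}[Y(0)\mid M(1)=1,M(0)=1,X=x]=\mu_{11}(x)$, and with $\tau_{m_1m_0}(x)=\mathbb{E}[Y(1)-Y(0)\mid M(1)=m_1,M(0)=m_0,X=x]$, $$\tau_{11}(x)=0,\qquad \tau_{00}(x)=\mu_{01}(x)-\mu_{00}(x),$$ and, when $p_{10}(x)-p_{11}(x)>0$, $$\tau_{01}(x)=\mu_{01}(x)-\frac{p_{10}(x)\mu_{10}(x)-p_{11}(x)\mu_{11}(x)}{p_{10}(x)-p_{11}(x)}.$$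
   Context: All observed variables and potential outcomes are random variables on one probability space; $Y(a,M(a'))$ denotes $Y(a,m)$ evaluated at the random value $m=M(a')$, and $\perp$ denotes (conditional) independence. Conditional statements hold almost surely wherever the conditioning event has positive conditional probability; in particular, each conditional mean given a principal stratum $(M(1),M(0))=(m_1,m_0)$ and $X=x$ is considered only where that stratum has positive conditional probability. All expectations are assumed finite. *)

(* Defs.v *)
From HB Require Import structures.
From mathcomp Require Import all_boot all_order all_algebra.
From mathcomp Require Import all_classical all_reals all_analysis.

Set Implicit Arguments.
Unset Strict Implicit.
Unset Printing Implicit Defensive.
Import Order.TTheory GRing.Theory Num.Theory.
Local Open Scope classical_set_scope.
Local Open Scope ring_scope.

Section rv_pair.
Context {d d1 d2 : measure_display} {Omega : measurableType d}
  {T1 : measurableType d1} {T2 : measurableType d2}.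

Definition rv_pair (U : {mfun Omega >-> T1}) (V : {mfun Omega >-> T2}) :
  Omega -> (T1 * T2)%type := fun w => (U w, V w).

Variables (U : {mfun Omega >-> T1}) (V : {mfun Omega >-> T2}).

Let measurable_rv_pair : measurable_fun setT (rv_pair U V).
Proof. exact: measurable_fun_pair. Qed.

HB.instance Definition _ :=
  isMeasurableFun.Build _ _ _ _ (rv_pair U V) measurable_rv_pair.

End rv_pair.

Section conditioning.
Context {d dW : measure_display} {Omega : measurableType d}
  {TW : measurableType dW} {R : realType}.
Variable P : probability Omega R.

(* [g] is a version of the regression function w |-> E[Z | W = w]; versions
   are unique up to equality almost everywhere for the law of W. *)
Definition is_cond_exp (Z : Omega -> R) (W : {mfun Omega >-> TW})
    (g : TW -> R) : Prop :=
  (distribution P W).-integrable setT (EFin \o g) /\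
  forall B : set TW, measurable B ->
    (\int[distribution P W]_(w in B) (g w)%:E =
     \int[P]_(omega in W @^-1` B) (Z omega)%:E)%E.

(* A fixed version of w |-> E[Z | W = w].  The default value is never used
   when Z is integrable, see [cond_expP]. *)
Definition cond_exp (Z : Omega -> R) (W : {mfun Omega >-> TW}) : TW -> R :=
  xget (fun=> 0) [set g | is_cond_exp Z W g].

Lemma cond_expP (Z : Omega -> R) (W : {mfun Omega >-> TW}) :
  P.-integrable setT (EFin \o Z) -> is_cond_exp Z W (cond_exp Z W).
Proof.
move=> intZ; apply: xgetPex.
have mW : measurable_fun setT W by [].
pose nu := measure_function_pushforward__canonical__charge_Charge
  (induced_charge intZ) mW.
have nuW : nu `<< distribution P W.
  apply/null_content_dominatesP => B mB PB0.
  have mWB : measurable (W @^-1` B).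
    by rewrite -[X in measurable X]setTI; apply: (mW measurableT _ mB).
  apply: null_set_integral => //.
  exact: measurable_int (integrableS measurableT mWB (@subsetT _ _) intZ).
pose f := Radon_Nikodym nu (distribution P W).
have fE : EFin \o (fine \o f) = f.
  by apply/funext => w /=; rewrite fineK// Radon_Nikodym_fin_num.
exists (fine \o f); split; first by rewrite fE; exact: Radon_Nikodym_integrable.
move=> B mB; under eq_integral do rewrite -[EFin _]/((EFin \o (fine \o f)) _) fE.
by rewrite -Radon_Nikodym_integral.
Qed.

Definition cond_prob (E : set Omega) (W : {mfun Omega >-> TW}) : TW -> R :=
  cond_exp (\1_E) W.

End conditioning.

(* U and V are conditionally independent given W on the part D of the range of
   W.  With W = (C, W') and D = [set w | w.1 = c] this is independence given
   C = c and W'. *)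
Definition cond_indep_on {d d1 d2 dW : measure_display}
    {Omega : measurableType d} {T1 : measurableType d1}
    {T2 : measurableType d2} {TW : measurableType dW} {R : realType}
    (P : probability Omega R) (U : {mfun Omega >-> T1})
    (V : {mfun Omega >-> T2}) (W : {mfun Omega >-> TW}) (D : set TW) : Prop :=
  forall (B : set T1) (C : set T2), measurable B -> measurable C ->
  {ae distribution P W, forall w, D w ->
    cond_prob P (U @^-1` B `&` V @^-1` C) W w =
    cond_prob P (U @^-1` B) W w * cond_prob P (V @^-1` C) W w}.

Definition cond_indep {d d1 d2 dW : measure_display}
    {Omega : measurableType d} {T1 : measurableType d1}
    {T2 : measurableType d2} {TW : measurableType dW} {R : realType}
    (P : probability Omega R) (U : {mfun Omega >-> T1})
    (V : {mfun Omega >-> T2}) (W : {mfun Omega >-> TW}) : Prop :=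
  cond_indep_on P U V W setT.

(* Main.v *)
(** The identification rests on two observations.

    A regression on a vector W made of X and binary variables reduces to
    regressions on X alone: if W = iota(X) on the event [W in D], then
    E[Z | W = iota x] P(W in D | X = x) = E[Z 1_(W in D) | X = x]
    for almost every x ([cond_exp_slice]).  Each quantity of the statement thus
    becomes a quotient of conditional expectations given X, in which
    consistency replaces (M, Y) by potential outcomes and conditional
    independence factors out P(A = a | X).

    Necessity and sufficiency force M(0) = S and M(1) <= M(0) almost surely.
    Hence the strata (1,1) and (0,0) are the events [M(1) = 1] and
    [M(0) = 0], and the stratum (0,s) is the event [M(1) = 0, S = s], on which
    the conditional independences given (X, S) apply. *)
Require Import Defs.
From HB Require Import structures.
From mathcomp Require Import all_boot all_order all_algebra.
From mathcomp Require Import all_classical all_reals all_analysis.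
From mathcomp Require Import measurable_realfun.

Set Implicit Arguments.
Unset Strict Implicit.
Unset Printing Implicit Defensive.
Import Order.TTheory GRing.Theory Num.Theory.
Local Open Scope classical_set_scope.
Local Open Scope ring_scope.

(** * Measures given by a density, and their images *)

Section density.
Context d (T : measurableType d) (R : realType).
Variable mu : {sigma_finite_measure set T -> \bar R}.
Local Open Scope ereal_scope.

(** Having the same integral over every measurable set, [k] and the Radon-Nikodym derivative of [nu]
    agree almost everywhere, so the change of variables known for the derivative carries over to
    [k]. *)
Lemma ge0_integral_density (nu : {finite_measure set T -> \bar R})
    (k : T -> \bar R) :
  measurable_fun setT k ->
  (forall A, measurable A -> nu A = \int[mu]_(x in A) k x) ->
  forall (E : set T) (f : T -> \bar R), measurable E -> measurable_fun E f ->
    (forall x, 0 <= f x) ->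
  \int[nu]_(x in E) f x = \int[mu]_(x in E) (f x * k x).
Proof.
move=> mk nuk E f mE mf f0.
have numu : nu `<< mu.
  apply/null_content_dominatesP => A mA muA; rewrite nuk//.
  by apply: null_set_integral => //; exact: measurable_funTS.
rewrite -(Radon_Nikodym_SigmaFinite.change_of_variables numu)//.
have rnT := Radon_Nikodym_SigmaFinite.f_integrable numu.
have rn : ae_eq mu setT (Radon_Nikodym_SigmaFinite.f nu mu) k.
  apply: integral_ae_eq => // A _ mA.
  by rewrite -nuk//; apply/esym; exact: Radon_Nikodym_SigmaFinite.f_integral.
apply: ae_eq_integral => //.
- by apply: emeasurable_funM => //; exact/measurable_funTS/measurable_int/rnT.
- by apply: emeasurable_funM => //; exact: measurable_funTS.
- by move: rn; apply: filterS => x /= -> .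
Qed.

End density.

(** The two proofs are arguments so that the finite measure structure declared below can be inferred
    from the term itself. *)
Definition weighted d (T : measurableType d) (R : realType)
    (mu : {measure set T -> \bar R}) (f : T -> R)
    (_ : mu.-integrable setT (EFin \o f)) (_ : forall x, 0 <= f x) :=
  fun A : set T => (\int[mu]_(x in A) (f x)%:E)%E.

Section weighted.
Context d (T : measurableType d) (R : realType).
Variables (mu : {measure set T -> \bar R}) (f : T -> R).
Hypotheses (intf : mu.-integrable setT (EFin \o f)) (f0 : forall x, 0 <= f x).
Local Open Scope ereal_scope.

Local Notation nu := (weighted intf f0).

Let nu0 : nu set0 = 0. Proof. by rewrite /weighted integral_set0. Qed.

Let nu_ge0 A : 0 <= nu A.
Proof. by apply: integral_ge0 => x _; rewrite lee_fin. Qed.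

Let nu_sigma_additive : semi_sigma_additive nu.
Proof.
apply: (@semi_sigma_additive_nng_induced _ _ _ mu (EFin \o f)).
  exact: measurable_int intf.
by move=> x; rewrite lee_fin.
Qed.

HB.instance Definition _ := isMeasure.Build _ _ _ nu
  nu0 nu_ge0 nu_sigma_additive.

Let nu_fin : fin_num_fun nu.
Proof.
by move=> A mA; apply: integrable_fin_num => //; exact: integrableS intf.
Qed.

HB.instance Definition _ := Measure_isFinite.Build _ _ _ nu nu_fin.

End weighted.

Section weighted_integral.
Context d (T : measurableType d) (R : realType).
Variables (mu : {sigma_finite_measure set T -> \bar R}) (f : T -> R).
Hypotheses (intf : mu.-integrable setT (EFin \o f)) (f0 : forall x, 0 <= f x).
Local Open Scope ereal_scope.

Lemma ge0_integral_weighted (E : set T) (g : T -> \bar R) :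
  measurable E -> measurable_fun E g -> (forall x, 0 <= g x) ->
  \int[weighted intf f0]_(x in E) g x = \int[mu]_(x in E) (g x * (f x)%:E).
Proof.
by move=> mE mg g0; apply: ge0_integral_density => //; exact: measurable_int intf.
Qed.

End weighted_integral.

(** When [mu] is a probability, the derivative of this measure with respect to the law of [W] is the
    regression of [Z] on [W]. *)
Definition weighted_law d dW (Omega : measurableType d)
    (TW : measurableType dW) (R : realType) (mu : {measure set Omega -> \bar R})
    (Z : Omega -> R) (iZ : mu.-integrable setT (EFin \o Z))
    (Z0 : forall w, 0 <= Z w) (W : {mfun Omega >-> TW}) : set TW -> \bar R :=
  pushforward (weighted iZ Z0) W.

Section weighted_law.
Context d dW (Omega : measurableType d) (TW : measurableType dW) (R : realType).
Variables (mu : {measure set Omega -> \bar R}) (Z : Omega -> R).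
Hypotheses (iZ : mu.-integrable setT (EFin \o Z)) (Z0 : forall w, 0 <= Z w).
Variable W : {mfun Omega >-> TW}.

Local Notation nu := (weighted_law iZ Z0 W).

Let nu0 : nu set0 = 0%E. Proof. exact: measure0. Qed.

Let nu_ge0 A : (0 <= nu A)%E. Proof. exact: measure_ge0. Qed.

Let nu_sigma_additive : semi_sigma_additive nu.
Proof. exact: measure_semi_sigma_additive. Qed.

HB.instance Definition _ := isMeasure.Build _ _ _ nu
  nu0 nu_ge0 nu_sigma_additive.

Let nu_fin : fin_num_fun nu.
Proof.
move=> B mB; apply: (fin_num_measure (weighted iZ Z0)).
by rewrite -[X in measurable X]setTI; exact: measurable_funPT.
Qed.

HB.instance Definition _ := Measure_isFinite.Build _ _ _ nu nu_fin.

End weighted_law.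

(** * Versions of conditional expectations *)

Section cond_exp_theory.
Context {d dW : measure_display} {Omega : measurableType d}
  {TW : measurableType dW} {R : realType}.
Variable P : probability Omega R.
Implicit Types (Z : Omega -> R) (W : {mfun Omega >-> TW}) (g : TW -> R).

Lemma measurable_preimage_mfun W B : measurable B -> measurable (W @^-1` B).
Proof.
by move=> mB; rewrite -[X in measurable X]setTI; exact: measurable_funPT.
Qed.

Lemma is_cond_exp_measurable Z W g : is_cond_exp P Z W g ->
  measurable_fun setT g.
Proof. by case=> /measurable_int /measurable_EFinP. Qed.

Lemma is_cond_exp_unique Z W g g' :
  is_cond_exp P Z W g -> is_cond_exp P Z W g' ->
  {ae distribution P W, forall w, g w = g' w}.
Proof.
move=> [ig gE] [ig' g'E].
have : ae_eq (distribution P W) setT (EFin \o g) (EFin \o g').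
  apply: integral_ae_eq => //; first exact: measurable_int ig'.
  by move=> B _ mB; rewrite gE// g'E.
by apply: filterS => w /(_ I) [].
Qed.

Lemma cond_exp_unique Z W g : P.-integrable setT (EFin \o Z) ->
  is_cond_exp P Z W g -> {ae distribution P W, forall w, cond_exp P Z W w = g w}.
Proof. by move=> iZ; apply: is_cond_exp_unique; exact: cond_expP. Qed.

(* The two sets of versions coincide, so the chosen versions are equal and not
   merely equal almost everywhere. *)
Lemma cond_exp_ae_eq Z Z' W :
  measurable_fun setT Z -> measurable_fun setT Z' ->
  {ae P, forall w, Z w = Z' w} -> cond_exp P Z W = cond_exp P Z' W.
Proof.
move=> mZ mZ' ZZ'; rewrite /cond_exp; congr xget; apply/seteqP.
have E B : measurable B -> (\int[P]_(omega in W @^-1` B) (Z omega)%:E =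
     \int[P]_(omega in W @^-1` B) (Z' omega)%:E)%E.
  move=> mB; apply: ae_eq_integral => //.
  - exact: measurable_preimage_mfun.
  - by apply: measurable_funTS; exact/measurable_EFinP.
  - by apply: measurable_funTS; exact/measurable_EFinP.
  - by move: ZZ'; apply: filterS => w /= ->.
by split=> g [ig gE]; split=> // B mB; rewrite gE// E.
Qed.

Lemma is_cond_expB Z Z' W g g' :
  P.-integrable setT (EFin \o Z) -> P.-integrable setT (EFin \o Z') ->
  is_cond_exp P Z W g -> is_cond_exp P Z' W g' ->
  is_cond_exp P (fun w => Z w - Z' w) W (fun w => g w - g' w).
Proof.
move=> iZ iZ' [ig gE] [ig' g'E]; split.
  by have := integrableB measurableT ig ig'.
move=> B mB; have mWB := measurable_preimage_mfun W mB.
have /= -> := @integralB_EFin _ _ _ (distribution P W) B g g' mB.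
- rewrite gE// g'E//.
  have /= -> // := @integralB_EFin _ _ _ P (W @^-1` B) Z Z' mWB.
  + exact: integrableS iZ.
  + exact: integrableS iZ'.
- exact: integrableS ig.
- exact: integrableS ig'.
Qed.

Lemma cond_expB Z Z' W :
  P.-integrable setT (EFin \o Z) -> P.-integrable setT (EFin \o Z') ->
  {ae distribution P W, forall w,
    cond_exp P (fun w => Z w - Z' w) W w = cond_exp P Z W w - cond_exp P Z' W w}.
Proof.
move=> iZ iZ'; apply: cond_exp_unique.
  by have := integrableB measurableT iZ iZ'.
by apply: is_cond_expB => //; exact: cond_expP.
Qed.

(* No integrability of g is required; in [cond_exp_slice] g is a regression
   function that is integrable on part of the space only. *)
Lemma cond_exp_ge0_pullout Z W : P.-integrable setT (EFin \o Z) ->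
  (forall w, 0 <= Z w) ->
  exists h : TW -> R, [/\ is_cond_exp P Z W h, forall w, 0 <= h w &
   forall (B : set TW) g, measurable B -> measurable_fun setT g ->
    (forall w, 0 <= g w) ->
    (\int[distribution P W]_(w in B) (g w * h w)%:E =
     \int[P]_(w in W @^-1` B) (g (W w) * Z w)%:E)%E].
Proof.
move=> iZ Z0.
have mW : measurable_fun setT W by [].
(* A measure instead of a charge: its derivative can be taken nonnegative everywhere, and change of
   variables holds for every nonnegative [g], infinite integrals included. *)
pose nu' := weighted_law iZ Z0 W.
have nuW : nu' `<< distribution P W.
  apply/null_content_dominatesP => B mB PB0.
  apply: null_set_integral => //; first exact: measurable_preimage_mfun.
  by apply: measurable_funTS; exact: measurable_int iZ.
pose f := Radon_Nikodym_SigmaFinite.f nu' (distribution P W).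
have f0 := Radon_Nikodym_SigmaFinite.f_ge0 nuW.
have fE : EFin \o (fine \o f) = f.
  apply/funext => w /=; rewrite fineK//.
  exact: Radon_Nikodym_SigmaFinite.f_fin_num.
exists (fine \o f); split.
- split; first by rewrite fE; exact: Radon_Nikodym_SigmaFinite.f_integrable.
  move=> B mB; under eq_integral do rewrite -[EFin _]/((EFin \o (fine \o f)) _) fE.
  by rewrite -Radon_Nikodym_SigmaFinite.f_integral.
- by move=> w /=; rewrite fine_ge0.
- move=> B g mB mg g0.
  under eq_integral do rewrite EFinM -[X in (_ * X)%E]/((EFin \o (fine \o f)) _) fE.
  rewrite (Radon_Nikodym_SigmaFinite.change_of_variables nuW
    (f := EFin \o g))//; last first.
    by apply: measurable_funTS; exact/measurable_EFinP.
  rewrite (ge0_integral_pushforward mW)//; last first.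
    by move=> w _; rewrite lee_fin.
    by apply: measurable_funTS; exact/measurable_EFinP.
  rewrite ge0_integral_weighted//.
  - exact: measurable_preimage_mfun.
  - apply: measurable_funTS; apply/measurable_EFinP.
    exact: measurableT_comp.
  - by move=> w; rewrite lee_fin.
Qed.

End cond_exp_theory.

(** * Integrability and integrals of products with indicators *)

Section indicator_products.
Context d (T : measurableType d) (R : realType).
Variable mu : {finite_measure set T -> \bar R}.
Implicit Types (f g : T -> R) (A D : set T).

Lemma integral_mul_indic f A D : measurable A -> measurable D ->
  (\int[mu]_(x in D) (f x * \1_A x)%:E = \int[mu]_(x in D `&` A) (f x)%:E)%E.
Proof.
move=> mA mD; rewrite integral_mkcondr; apply: eq_integral => x _.
by rewrite epatch_indic /= EFinM.
Qed.

Lemma integrable_mul_indic f A : measurable A ->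
  mu.-integrable setT (EFin \o f) ->
  mu.-integrable setT (EFin \o (fun x => f x * \1_A x)).
Proof.
move=> mA if_; apply: le_integrable (if_) => //.
  apply/measurable_EFinP; apply: measurable_funM => //.
  by apply/measurable_EFinP; exact: measurable_int if_.
move=> x _ /=; rewrite lee_fin normrM ler_piMr// indicE.
by case: (_ \in _); rewrite ?normr0 ?normr1.
Qed.

Lemma integrable_ae_eq f g : measurable_fun setT g ->
  {ae mu, forall x, f x = g x} ->
  mu.-integrable setT (EFin \o f) -> mu.-integrable setT (EFin \o g).
Proof.
move=> mg fg /integrableP[mf foo]; apply/integrableP; split.
  exact/measurable_EFinP.
rewrite (ae_eq_integral (fun x => `|(f x)%:E|)%E) //.
- by apply: measurableT_comp => //; exact/measurable_EFinP.
- by apply: measurableT_comp.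
- by move: fg; apply: filterS => x /= ->.
Qed.

Lemma integrable_ge0_lty f : measurable_fun setT f -> (forall x, 0 <= f x) ->
  (\int[mu]_x (f x)%:E < +oo)%E -> mu.-integrable setT (EFin \o f).
Proof.
move=> mf f0 foo; apply/integrableP; split; first exact/measurable_EFinP.
by under eq_integral do rewrite gee0_abs ?lee_fin//.
Qed.

End indicator_products.

Lemma filterS4 T (F : set_system T) : Filter F ->
  forall A B C D E : set T, (forall x, A x -> B x -> C x -> D x -> E x) ->
  F A -> F B -> F C -> F D -> F E.
Proof.
move=> FF A B C D E H FA FB FC FD.
by apply: filterS3 (filterI FA FB) FC FD => x [Ax Bx]; exact: H.
Qed.

Lemma filterS5 T (F : set_system T) : Filter F ->
  forall A B C D E G : set T,
  (forall x, A x -> B x -> C x -> D x -> E x -> G x) ->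
  F A -> F B -> F C -> F D -> F E -> F G.
Proof.
move=> FF A B C D E G H FA FB FC FD FE.
by apply: filterS4 (filterI FA FB) FC FD FE => x [Ax Bx]; exact: H.
Qed.

(** * Regression on a slice of the conditioning vector *)

Section slice.
Context {d dW dX : measure_display} {Omega : measurableType d}
  {TW : measurableType dW} {TX : measurableType dX} {R : realType}.
Variables (P : probability Omega R).
Variables (W : {mfun Omega >-> TW}) (X : {mfun Omega >-> TX}).
Variables (rho : TW -> TX) (iota : TX -> TW) (D : set TW).
Hypotheses (mrho : measurable_fun setT rho) (miota : measurable_fun setT iota).
Hypothesis mD : measurable D.
Hypothesis rhoW : forall w, rho (W w) = X w.
Hypothesis iotaK : forall y, D y -> iota (rho y) = y.

Let mE : measurable (W @^-1` D).
Proof. exact: measurable_preimage_mfun. Qed.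

(** Let [N] be null for the law of [W] and [B] the set of [x] with [iota x] in [N] where the slice
    has positive conditional probability. As [iota] inverts [rho] on [D], integrating that
    probability over [B] gives at most the probability that [W] lies in [N], which is zero. A
    positive function with zero integral lives on a null set. *)
Lemma ae_slice (Q : TW -> Prop) : {ae distribution P W, forall y, Q y} ->
  {ae distribution P X, forall x, 0 < cond_prob P (W @^-1` D) X x ->
    Q (iota x)}.
Proof.
move=> [N [mN N0 subN]].
pose g := cond_prob P (W @^-1` D) X.
have [ig gE] : is_cond_exp P (\1_(W @^-1` D)) X g.
  by apply: cond_expP; exact: integrable_indic.
have mg : measurable_fun setT g by apply/measurable_EFinP; exact: measurable_int ig.
pose B := iota @^-1` N `&` [set x | 0 < g x].
have mB : measurable B.
  apply: measurableI; first by rewrite -[X in measurable X]setTI; exact: miota.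
  rewrite -[X in measurable X]setTI.
  have -> : [set x | 0 < g x] = g @^-1` `]0, +oo[.
    by apply/seteqP; split=> x /=; rewrite in_itv/= andbT.
  exact: mg.
have gB0 : (\int[distribution P X]_(x in B) `|(g x)%:E| = 0)%E.
  under eq_integral => x /set_mem [_ /ltW g0] do rewrite gee0_abs ?lee_fin//.
  rewrite gE// integral_indic//; last exact: measurable_preimage_mfun.
  apply: (@subset_measure0 _ _ _ P _ (W @^-1` N)) => //.
  - by apply: measurableI => //; exact: measurable_preimage_mfun.
  - exact: measurable_preimage_mfun.
  - by move=> w [DW [/= Nw _]]; rewrite -rhoW iotaK in Nw.
have /(ae_eq_integral_abs _ mB) : measurable_fun B (EFin \o g).
  by apply: measurable_funTS; exact: measurable_int ig.
move=> /(_ (distribution P X)) [/(_ gB0) + _].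
apply: filterS => x /= Bx0 gx0; apply: contrapT => Qx.
have Bx : B x by split => //; exact: (subN (iota x) Qx).
have [gx] := Bx0 Bx.
by move: gx0; rewrite -[cond_prob _ _ _]/g gx ltxx.
Qed.

(** The product of [G (iota x)] and [k x] is a version of the right-hand side: pulling [G \o iota]
    out of [k] leaves an integral over an event determined by [W], on which [iota (X w)] is [W w],
    and there the defining property of [G] applies. *)
Let ge0_cond_exp_slice Z : P.-integrable setT (EFin \o Z) ->
  (forall w, 0 <= Z w) ->
  {ae distribution P X, forall x,
    cond_exp P Z W (iota x) * cond_prob P (W @^-1` D) X x =
    cond_exp P (fun w => Z w * \1_(W @^-1` D) w) X x}.
Proof.
move=> iZ Z0.
have iE : P.-integrable setT (EFin \o \1_(W @^-1` D)) by exact: integrable_indic.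
have [G [GZ G0 _]] := cond_exp_ge0_pullout W iZ Z0.
have [|k [kE k0 kpull]] := cond_exp_ge0_pullout X iE.
  by move=> w; rewrite indicE.
have mG := is_cond_exp_measurable GZ.
have mk := is_cond_exp_measurable kE.
have iZE := integrable_mul_indic mE iZ.
have vers : forall B, measurable B ->
    (\int[distribution P X]_(x in B) (G (iota x) * k x)%:E =
     \int[P]_(w in X @^-1` B) (Z w * \1_(W @^-1` D) w)%:E)%E.
  move=> B mB.
  have mXB : measurable (X @^-1` B) by exact: measurable_preimage_mfun.
  have mGi : measurable_fun setT (G \o iota) by exact: measurableT_comp mG miota.
  have /= -> := kpull B _ mB mGi (fun x => G0 _).
  rewrite !(integral_mul_indic P _ mE mXB).
  pose B' := rho @^-1` B `&` D.
  have mB' : measurable B'.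
    by apply: measurableI => //; rewrite -[X in measurable X]setTI; exact: mrho.
  have -> : X @^-1` B `&` W @^-1` D = W @^-1` B'.
    by apply/seteqP; split=> w [/= Bw Dw]; split=> //=; rewrite ?rhoW// -rhoW.
  rewrite -GZ.2// (ge0_integral_pushforward (phi := W))//.
  - apply: eq_integral => w /set_mem [_ DWw] /=.
    by rewrite -rhoW iotaK.
  - by apply: measurable_funTS; exact/measurable_EFinP.
  - by move=> y _; rewrite lee_fin.
have ver : is_cond_exp P (fun w => Z w * \1_(W @^-1` D) w) X
    (fun x => G (iota x) * k x).
  split=> //; apply: integrable_ge0_lty.
  - by apply: measurable_funM => //; exact: measurableT_comp.
  - by move=> x; rewrite mulr_ge0.
  - rewrite vers//; have /integrableP[_] := iZE.
    by under eq_integral do rewrite gee0_abs ?lee_fin ?mulr_ge0 ?indicE//.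
have := cond_exp_unique iZE ver.
have := ae_slice (cond_exp_unique iZ GZ).
have := cond_exp_unique iE kE.
apply: filterS3 => x kx Gx ->.
rewrite -kx in Gx *; rewrite /cond_prob.
(* Where the slice has conditional probability zero, the regression on [W] is arbitrary at [iota x],
   but it is multiplied by zero. *)
have := k0 x; rewrite -kx le_eqVlt => /predU1P[<-|kx0]; first by rewrite !mulr0.
by rewrite Gx.
Qed.

(** Positive and negative parts are treated separately. Additivity of the regression on [W] holds
    for almost every value of [W] only; [ae_slice] carries it to those [x] whose slice has positive
    probability, and elsewhere both sides are multiplied by zero. *)
Lemma cond_exp_slice Z : P.-integrable setT (EFin \o Z) ->
  {ae distribution P X, forall x,
    cond_exp P Z W (iota x) * cond_prob P (W @^-1` D) X x =
    cond_exp P (fun w => Z w * \1_(W @^-1` D) w) X x}.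
Proof.
move=> iZ.
have iZp := integrable_funrpos measurableT iZ.
have iZn := integrable_funrneg measurableT iZ.
have ZE : Z = (fun w => Z^\+ w - Z^\- w) by rewrite -[LHS]funrposBneg.
have ZE1 : (fun w => Z w * \1_(W @^-1` D) w) =
    (fun w => Z^\+ w * \1_(W @^-1` D) w - Z^\- w * \1_(W @^-1` D) w).
  by apply/funext => w; rewrite -mulrBl; congr (_ * _); rewrite {1}ZE.
have k0 : {ae distribution P X, forall x, 0 <= cond_prob P (W @^-1` D) X x}.
  have iE : P.-integrable setT (EFin \o \1_(W @^-1` D)) by exact: integrable_indic.
  have [|k [kE k0 _]] := cond_exp_ge0_pullout X iE.
    by move=> w; rewrite indicE.
  by have := cond_exp_unique iE kE; apply: filterS => x; rewrite /cond_prob => ->.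
have := cond_expB X (integrable_mul_indic mE iZp) (integrable_mul_indic mE iZn).
have := ge0_cond_exp_slice iZp (funrpos_ge0 Z).
have := ge0_cond_exp_slice iZn (funrneg_ge0 Z).
have := ae_slice (cond_expB W iZp iZn).
move: k0; apply: filterS5 => x kx ZWx nx px.
rewrite ZE1 => ->; rewrite -px -nx -mulrBl.
move: kx ZWx; rewrite le_eqVlt => /predU1P[<-|kx0]; first by rewrite !mulr0.
by rewrite -ZE => ->.
Qed.

End slice.

(** * The product rule of conditional independence for integrable functions *)

Section cond_indep_theory.
Context {d d1 d2 dW : measure_display} {Omega : measurableType d}
  {T1 : measurableType d1} {T2 : measurableType d2} {TW : measurableType dW}
  {R : realType}.
Variables (P : probability Omega R) (U : {mfun Omega >-> T1})
  (V : {mfun Omega >-> T2}) (W : {mfun Omega >-> TW}).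
Hypothesis UVW : cond_indep P U V W.

(** With [h] and [k] versions of the two factors, [h * k] is shown to be a version of the left-hand
    side. Over [B], pulling [k] out turns its integral into that of [f (U o) * k (W o)] on the event
    that [W] lies in [B]. It remains to replace [k (W o)] by the indicator of the event on [V],
    which is done by comparing two weighted laws of [U]. *)
Let ge0_cond_indep_exp (f : T1 -> R) (C : set T2) :
  measurable C -> measurable_fun setT f -> (forall u, 0 <= f u) ->
  P.-integrable setT (EFin \o (f \o U)) ->
  {ae distribution P W, forall w,
    cond_exp P (fun o => f (U o) * \1_(V @^-1` C) o) W w =
    cond_exp P (f \o U) W w * cond_prob P (V @^-1` C) W w}.
Proof.
move=> mC mf f0 ifU.
have mE : measurable (V @^-1` C) by exact: measurable_preimage_mfun.
have iE : P.-integrable setT (EFin \o \1_(V @^-1` C)) by exact: integrable_indic.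
have [h [hE h0 hpull]] := cond_exp_ge0_pullout W ifU (fun w => f0 (U w)).
have [|k [kE k0 kpull]] := cond_exp_ge0_pullout W iE.
  by move=> w; rewrite indicE.
have mh := is_cond_exp_measurable hE.
have mk := is_cond_exp_measurable kE.
have mkW : measurable_fun setT (k \o W) by exact: measurableT_comp mk _.
have ikW : P.-integrable setT (EFin \o (k \o W)).
  apply: integrable_ge0_lty => //; first by move=> w; exact: k0.
  have [/integrableP[_ +] _] := kE.
  under eq_integral do rewrite gee0_abs ?lee_fin//.
  rewrite (ge0_integral_pushforward (phi := W))//.
    exact/measurable_EFinP.
  by move=> w _; rewrite lee_fin.
have ifUE := integrable_mul_indic mE ifU.
have vers B : measurable B ->
    (\int[distribution P W]_(w in B) (h w * k w)%:E =
     \int[P]_(o in W @^-1` B) (f (U o) * \1_(V @^-1` C) o)%:E)%E.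
  move=> mB; have mWB : measurable (W @^-1` B) by exact: measurable_preimage_mfun.
  under eq_integral do rewrite mulrC.
  rewrite hpull//.
  have ind0 (D : set Omega) w : 0 <= \1_D w :> R by rewrite indicE.
  have i1 := integrable_mul_indic mWB iE.
  have i2 := integrable_mul_indic mWB ikW.
  have p1 w : 0 <= \1_(V @^-1` C) w * \1_(W @^-1` B) w :> R by rewrite mulr_ge0.
  have p2 w : 0 <= (k \o W) w * \1_(W @^-1` B) w :> R by rewrite mulr_ge0//= k0.
  (* The product rule makes these two finite measures on T1 agree, hence they
     integrate f to the same value. *)
  have m12 A : measurable A -> weighted_law i2 p2 U A = weighted_law i1 p1 U A.
    move=> mA; have mUA : measurable (U @^-1` A) by exact: measurable_preimage_mfun.
    have iA : P.-integrable setT (EFin \o \1_(U @^-1` A)).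
      exact: integrable_indic.
    rewrite /weighted_law /pushforward /weighted.
    rewrite (integral_mul_indic P (k \o W) mWB mUA).
    rewrite (integral_mul_indic P (\1_(V @^-1` C)) mWB mUA).
    rewrite setIC -(integral_mul_indic P (k \o W) mUA mWB).
    (* Pulling [k] out of the regression of the indicator of [U] in [A] moves the integral to the
       law of [W], where the product rule for events is available. *)
    have [|hA [hAE hA0 hApull]] := cond_exp_ge0_pullout W iA.
      by move=> w; rewrite indicE.
    rewrite -(hApull B k mB mk k0).
    have iAE : P.-integrable setT (EFin \o \1_(U @^-1` A `&` V @^-1` C)).
      by apply: integrable_indic; exact: measurableI.
    have [iq qE] := cond_expP W iAE.
    rewrite (ae_eq_integral
      (EFin \o cond_exp P (\1_(U @^-1` A `&` V @^-1` C)) W))//.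
    - rewrite qE// integral_indic//; last exact: measurableI.
      rewrite integral_indic//; last exact: measurableI.
      by congr (P _); apply/seteqP; split=> w /= [] => [[? ?] ?|? [? ?]].
    - apply: measurable_funTS; apply/measurable_EFinP.
      by apply: measurable_funM => //; exact: is_cond_exp_measurable hAE.
    - by apply: measurable_funTS; exact: measurable_int iq.
    - have := UVW mA mC.
      have := cond_exp_unique iA hAE.
      have := cond_exp_unique iE kE.
      apply: filterS3 => w kw hw /(_ I); rewrite /cond_prob kw hw => qw _ /=.
      by rewrite qw mulrC.
  have mfE : measurable_fun setT (EFin \o f) by exact/measurable_EFinP.
  transitivity (\int[weighted_law i2 p2 U]_u (f u)%:E)%E.
    rewrite (ge0_integral_pushforward (phi := U))//; last first.
      by move=> u _; rewrite lee_fin.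
    rewrite preimage_setT ge0_integral_weighted//=; last 2 first.
    + exact: measurable_int ifU.
    + by move=> w; rewrite lee_fin.
    rewrite -[in LHS](setTI (W @^-1` B)) -integral_mul_indic//.
    by apply: eq_integral => w _; rewrite -EFinM mulrA [f _ * _]mulrC.
  transitivity (\int[weighted_law i1 p1 U]_u (f u)%:E)%E.
    by apply: eq_measure_integral => A mA _; exact: m12.
  rewrite (ge0_integral_pushforward (phi := U))//; last first.
    by move=> u _; rewrite lee_fin.
  rewrite preimage_setT ge0_integral_weighted//=; last 2 first.
  + exact: measurable_int ifU.
  + by move=> w; rewrite lee_fin.
  rewrite -[in RHS](setTI (W @^-1` B)) -integral_mul_indic//.
  by apply: eq_integral => w _; rewrite -EFinM mulrA.
have ver : is_cond_exp P (fun o => f (U o) * \1_(V @^-1` C) o) W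
    (fun w => h w * k w).
  split=> //; apply: integrable_ge0_lty.
  - exact: measurable_funM.
  - by move=> x; rewrite mulr_ge0.
  - rewrite vers//; have /integrableP[_] := ifUE.
    by under eq_integral do rewrite gee0_abs ?lee_fin ?mulr_ge0 ?indicE ?f0//.
have := cond_exp_unique ifUE ver.
have := cond_exp_unique ifU hE.
have := cond_exp_unique iE kE.
by apply: filterS3 => w; rewrite /cond_prob => -> -> ->.
Qed.

Lemma cond_indep_exp (f : T1 -> R) (C : set T2) :
  measurable C -> measurable_fun setT f ->
  P.-integrable setT (EFin \o (f \o U)) ->
  {ae distribution P W, forall w,
    cond_exp P (fun o => f (U o) * \1_(V @^-1` C) o) W w =
    cond_exp P (f \o U) W w * cond_prob P (V @^-1` C) W w}.
Proof.
move=> mC mf ifU.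
have mE : measurable (V @^-1` C) by exact: measurable_preimage_mfun.
have ip : P.-integrable setT (EFin \o (f^\+ \o U)).
  exact: integrable_funrpos measurableT ifU.
have in_ : P.-integrable setT (EFin \o (f^\- \o U)).
  exact: integrable_funrneg measurableT ifU.
have fE u : f u = f^\+ u - f^\- u by rewrite -{1}(funrposBneg f).
have fUE : f \o U = (fun o => (f^\+ \o U) o - (f^\- \o U) o).
  by apply/funext => o /=; rewrite {1}fE.
have fUE1 : (fun o => f (U o) * \1_(V @^-1` C) o) =
    (fun o => (f^\+ \o U) o * \1_(V @^-1` C) o - (f^\- \o U) o * \1_(V @^-1` C) o).
  by apply/funext => o /=; rewrite -mulrBl -fE.
have := ge0_cond_indep_exp mC (measurable_funrpos mf) (funrpos_ge0 f) ip.
have := ge0_cond_indep_exp mC (measurable_funrneg mf) (funrneg_ge0 f) in_.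
have := cond_expB W ip in_.
have := cond_expB W (integrable_mul_indic mE ip) (integrable_mul_indic mE in_).
apply: filterS4 => w BE BU nE pE.
by rewrite fUE1 BE fUE BU pE nE mulrBl.
Qed.

End cond_indep_theory.

(** * Slices that fix one, two or three binary variables *)

Section discrete_slices.
Context {d dX : measure_display} {Omega : measurableType d}
  {TX : measurableType dX} {R : realType}.
Variables (P : probability Omega R) (X : {mfun Omega >-> TX}).
Implicit Types (K L N : {mfun Omega >-> bool}) (k l n : bool) (Z : Omega -> R).

Lemma measurable_fiber d' (T : measurableType d') (g : T -> bool) k :
  measurable_fun setT g -> measurable [set y | g y = k].
Proof.
by move=> mg; rewrite -[X in measurable X]setTI; exact: (mg measurableT [set k]).
Qed.

Lemma cond_exp_slice1 K k Z : P.-integrable setT (EFin \o Z) ->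
  {ae distribution P X, forall x,
    cond_exp P Z (rv_pair K X) (k, x) * cond_prob P [set w | K w = k] X x =
    cond_exp P (fun w => Z w * \1_[set w | K w = k] w) X x}.
Proof.
apply: (@cond_exp_slice _ _ _ _ _ _ _ P (rv_pair K X) X snd (pair k)
  [set y | y.1 = k]) => //.
- exact: measurable_fiber.
- by move=> [k' x] /= ->.
Qed.

Lemma cond_exp_slice2 K L k l Z : P.-integrable setT (EFin \o Z) ->
  {ae distribution P X, forall x,
    cond_exp P Z (rv_pair K (rv_pair L X)) (k, (l, x)) *
      cond_prob P [set w | K w = k /\ L w = l] X x =
    cond_exp P (fun w => Z w * \1_[set w | K w = k /\ L w = l] w) X x}.
Proof.
apply: (@cond_exp_slice _ _ _ _ _ _ _ P (rv_pair K (rv_pair L X)) X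
  (snd \o snd) (fun x => (k, (l, x))) [set y | y.1 = k /\ y.2.1 = l]) => //.
- exact: measurableT_comp.
- exact: measurableT_comp (pair1_measurable k) (pair1_measurable l).
- apply: measurableI; apply: measurable_fiber => //.
  exact: measurableT_comp.
- by move=> [k' [l' x]] /= [-> ->].
Qed.

Lemma cond_exp_slice3 K L N k l n Z : P.-integrable setT (EFin \o Z) ->
  {ae distribution P X, forall x,
    cond_exp P Z (rv_pair K (rv_pair L (rv_pair N X))) (k, (l, (n, x))) *
      cond_prob P [set w | [/\ K w = k, L w = l & N w = n]] X x =
    cond_exp P
      (fun w => Z w * \1_[set w | [/\ K w = k, L w = l & N w = n]] w) X x}.
Proof.
apply: (@cond_exp_slice _ _ _ _ _ _ _ P (rv_pair K (rv_pair L (rv_pair N X))) X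
  (snd \o (snd \o snd)) (fun x => (k, (l, (n, x))))
  [set y | [/\ y.1 = k, y.2.1 = l & y.2.2.1 = n]]) => //.
- by apply: measurableT_comp => //; exact: measurableT_comp.
- exact: measurableT_comp (pair1_measurable k) (measurableT_comp
    (pair1_measurable l) (pair1_measurable n)).
- rewrite (_ : mkset _ = [set y | y.1 = k] `&`
    ([set y | y.2.1 = l] `&` [set y | y.2.2.1 = n])); last first.
    by apply/seteqP; split=> y /= => [[? ? ?]|[? [? ?]]].
  apply: measurableI; first exact: measurable_fiber.
  apply: measurableI; apply: measurable_fiber; first exact: measurableT_comp.
  by apply: measurableT_comp => //; exact: measurableT_comp.
- by move=> [k' [l' [n' x]]] /= [-> -> ->].
Qed.

(** Here the binary variable comes last, matching the vector [rv_pair X S] on which the assumptions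
    given the baseline variable condition. *)
Lemma cond_exp_slicer K k Z : P.-integrable setT (EFin \o Z) ->
  {ae distribution P X, forall x,
    cond_exp P Z (rv_pair X K) (x, k) * cond_prob P [set w | K w = k] X x =
    cond_exp P (fun w => Z w * \1_[set w | K w = k] w) X x}.
Proof.
apply: (@cond_exp_slice _ _ _ _ _ _ _ P (rv_pair X K) X fst (pair^~ k)
  [set y | y.2 = k]) => //.
- exact: measurable_fiber.
- by move=> [x k'] /= ->.
Qed.

Lemma ae_slicer K k (Q : TX * bool -> Prop) :
  {ae distribution P (rv_pair X K), forall y, Q y} ->
  {ae distribution P X, forall x, 0 < cond_prob P [set w | K w = k] X x ->
    Q (x, k)}.
Proof.
apply: (@ae_slice _ _ _ _ _ _ _ P (rv_pair X K) X fst (pair^~ k)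
  [set y | y.2 = k]) => //.
- exact: measurable_fiber.
- by move=> [x k'] /= ->.
Qed.

Lemma ae_slice2 K L k l (Q : bool * (bool * TX) -> Prop) :
  {ae distribution P (rv_pair K (rv_pair L X)), forall y, Q y} ->
  {ae distribution P X, forall x,
    0 < cond_prob P [set w | K w = k /\ L w = l] X x -> Q (k, (l, x))}.
Proof.
apply: (@ae_slice _ _ _ _ _ _ _ P (rv_pair K (rv_pair L X)) X
  (snd \o snd) (fun x => (k, (l, x))) [set y | y.1 = k /\ y.2.1 = l]) => //.
- exact: measurableT_comp (pair1_measurable k) (pair1_measurable l).
- apply: measurableI; apply: measurable_fiber => //.
  exact: measurableT_comp.
- by move=> [k' [l' x]] /= [-> ->].
Qed.

End discrete_slices.

(** * Conditional probabilities equal to zero or one *)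

Section cond_prob_01.
Context {d dW : measure_display} {Omega : measurableType d}
  {TW : measurableType dW} {R : realType}.
Variables (P : probability Omega R) (W : {mfun Omega >-> TW}).
Variables (E : set Omega) (D : set TW).
Hypotheses (mE : measurable E) (mD : measurable D).

Let mWD : measurable (W @^-1` D).
Proof. exact: measurable_preimage_mfun. Qed.

Let integral_cond_prob :
  (\int[distribution P W]_(y in D) (cond_prob P E W y)%:E =
   P (E `&` W @^-1` D))%E.
Proof.
have iE : P.-integrable setT (EFin \o \1_E) by exact: integrable_indic.
by rewrite (cond_expP W iE).2// integral_indic.
Qed.

(** For [r] equal to 0 or 1 this turns a degenerate conditional probability into an almost sure
    inclusion of events. *)
Let integral_cond_prob_cst r :
  {ae distribution P W, forall y, D y -> cond_prob P E W y = r} ->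
  (P (E `&` W @^-1` D) = r%:E * P (W @^-1` D))%E.
Proof.
move=> Er; rewrite -integral_cond_prob.
have iE : P.-integrable setT (EFin \o \1_E) by exact: integrable_indic.
have [ig _] := cond_expP W iE.
rewrite (ae_eq_integral (cst r%:E))//.
- by rewrite integral_cst.
- by apply: measurable_funTS; exact: measurable_int ig.
- by move: Er; apply: filterS => y /[apply] /= ->.
Qed.

Lemma ae_of_cond_prob0 :
  {ae distribution P W, forall y, D y -> cond_prob P E W y = 0} ->
  {ae P, forall w, D (W w) -> ~ E w}.
Proof.
move=> /integral_cond_prob_cst; rewrite mul0e => E0.
exists (E `&` W @^-1` D); split=> //; first exact: measurableI.
by move=> w /= /not_implyP[DW /contrapT].
Qed.

Lemma ae_of_cond_prob1 :
  {ae distribution P W, forall y, D y -> cond_prob P E W y = 1} ->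
  {ae P, forall w, D (W w) -> E w}.
Proof.
move=> /integral_cond_prob_cst; rewrite mul1e => E1.
exists (W @^-1` D `\` E); split.
- exact: measurableD.
- rewrite measureD ?ltey_eq ?fin_num_measure// setIC.
  by rewrite [X in (_ - X)%E]E1 subee// fin_num_measure.
- by move=> w /= /not_implyP.
Qed.

End cond_prob_01.

Lemma ae_and d (T : measurableType d) (R : realType)
    (mu : {measure set T -> \bar R}) (Q Q' : T -> Prop) :
  {ae mu, forall x, Q x} -> {ae mu, forall x, Q' x} ->
  {ae mu, forall x, Q x /\ Q' x}.
Proof. by apply: filterS2. Qed.

(** One exceptional null set then serves all values of the binary indices. *)
Lemma ae_bool d (T : measurableType d) (R : realType)
    (mu : {measure set T -> \bar R}) (Q : bool -> T -> Prop) :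
  (forall b, {ae mu, forall x, Q b x}) -> {ae mu, forall x b, Q b x}.
Proof.
move=> Qb; apply: filterS2 (Qb true) (Qb false) => x Qt Qf.
by case.
Qed.

(** * Identification of the principal strata and of their effects *)

Theorem mainTheorem5 (d dX : measure_display) (Omega : measurableType d)
    (TX : measurableType dX) (R : realType) (P : probability Omega R)
    (X : {RV P >-> TX}) (A M S : {RV P >-> bool}) (Y : {RV P >-> R})
    (Mpot : bool -> {RV P >-> bool})
    (Ypot : bool -> bool -> {RV P >-> R})
    (Yint : forall a m : bool, P.-integrable setT (EFin \o Ypot a m))
    (consistencyM : forall a : bool,
      {ae P, forall w, A w = a -> M w = Mpot a w})
    (consistencyY : forall a m : bool,
      {ae P, forall w, A w = a -> M w = m -> Y w = Ypot a m w})
    (positivityA : forall a : bool, {ae distribution P X, forall x,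
      0 < cond_prob P [set w | A w = a] X x})
    (positivityM : forall a m : bool, {ae distribution P X, forall x,
      0 < cond_prob P [set w | M w = m] (rv_pair A X) (a, x)})
    (ignorabilityA : forall a m : bool,
      cond_indep P (rv_pair (Ypot a m) (Mpot a)) A X)
    (ignorabilityM : forall a m : bool,
      cond_indep_on P (Ypot a m) M (rv_pair A X) [set ax | ax.1 = a])
    (necessity : forall b : bool,
      {ae distribution P (rv_pair S X), forall sx, sx.1 = false ->
        cond_prob P [set w | Mpot b w = true] (rv_pair S X) sx = 0})
    (sufficiency :
      {ae distribution P (rv_pair S X), forall sx, sx.1 = true ->
        cond_prob P [set w | Mpot false w = true] (rv_pair S X) sx = 1})
    (indepSA : cond_indep P S A X)
    (ignorabilityAS : forall a m : bool,
      cond_indep P (rv_pair (Ypot a m) (Mpot a)) A (rv_pair X S))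
    (ignorabilityMS : forall a m : bool,
      cond_indep_on P (Ypot a m) M (rv_pair A (rv_pair X S))
        [set axs | axs.1 = a])
    (exclusionS : cond_indep P Y S (rv_pair A (rv_pair M X))) :
  let Ya (a : bool) : Omega -> R := fun w => Ypot a (Mpot a w) w in
  let p (m a : bool) (x : TX) : R :=
    cond_prob P [set w | M w = m] (rv_pair A X) (a, x) in
  let mu (m a : bool) (x : TX) : R :=
    cond_exp P Y (rv_pair M (rv_pair A X)) (m, (a, x)) in
  let muS (m a s : bool) (x : TX) : R :=
    cond_exp P Y (rv_pair M (rv_pair A (rv_pair S X))) (m, (a, (s, x))) in
  let Pstratum (m1 m0 : bool) (x : TX) : R :=
    cond_prob P [set w | Mpot true w = m1 /\ Mpot false w = m0] X x in
  let Estratum (Z : Omega -> R) (m1 m0 : bool) (x : TX) : R :=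
    cond_exp P Z (rv_pair (Mpot true) (rv_pair (Mpot false) X))
      (m1, (m0, x)) in
  let tau (m1 m0 : bool) (x : TX) : R :=
    Estratum (fun w => Ya true w - Ya false w) m1 m0 x in
  {ae distribution P X, forall x,
    [/\ [/\ Pstratum true true x = p true true x,
            Pstratum false false x = p false false x &
            Pstratum false true x = p true false x - p true true x],
        (0 < Pstratum true true x ->
           Estratum (Ya true) true true x = mu true true x) /\
        (0 < Pstratum false false x ->
           Estratum (Ya false) false false x = mu false false x),
        (0 < Pstratum false false x ->
           Estratum (Ya true) false false x = muS false true false x /\
           muS false true false x = mu false true x) /\
        (0 < Pstratum false true x ->
           Estratum (Ya true) false true x = muS false true true x /\
           muS false true true x = mu false true x) &
        (0 < p true false x - p true true x ->
           Estratum (Ya false) false true x =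
           (p true false x * mu true false x -
            p true true x * Estratum (Ya false) true true x) /
           (p true false x - p true true x))]} /\
  ({ae distribution P X, forall x, 0 < Pstratum true true x ->
      Estratum (Ypot false true) true true x =
      Estratum (Ypot true true) true true x} ->
   {ae distribution P X, forall x,
     [/\ 0 < Pstratum true true x ->
           Estratum (Ya false) true true x = mu true true x,
         0 < Pstratum true true x -> tau true true x = 0,
         0 < Pstratum false false x ->
           tau false false x = mu false true x - mu false false x &
         0 < p true false x - p true true x ->
           tau false true x =
           mu false true x -
           (p true false x * mu true false x - p true true x * mu true true x) /
           (p true false x - p true true x)]}).
Proof.
move=> Ya p mu muS Pstratum Estratum tau.
pose e (Z : Omega -> R) x := cond_exp P Z X x.
pose i (K : {RV P >-> bool}) k : Omega -> R := \1_[set w | K w = k].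
have mev (K : {RV P >-> bool}) k : measurable [set w | K w = k].
  exact: measurable_fiber.
have ifun (B : set Omega) : measurable B ->
    P.-integrable setT (EFin \o (\1_B : Omega -> R)).
  by move=> mB; exact: integrable_indic.
have iE (K : {RV P >-> bool}) k w : i K k w = (K w == k)%:R.
  by rewrite /i indicE; congr (_%:R); congr nat_of_bool; apply/idP/eqP; rewrite inE.
have ii (K : {RV P >-> bool}) k : P.-integrable setT (EFin \o i K k) by exact: ifun.
have iM Z (K : {RV P >-> bool}) k : P.-integrable setT (EFin \o Z) ->
    P.-integrable setT (EFin \o (fun w => Z w * i K k w)).
  by move=> iZ; exact: integrable_mul_indic.
have mI Z : P.-integrable setT (EFin \o Z) -> measurable_fun setT Z.
  by move=> iZ; apply/measurable_EFinP; exact: measurable_int iZ.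
have i2E (K L : {RV P >-> bool}) k l w :
    \1_[set w | K w = k /\ L w = l] w = i K k w * i L l w.
  by rewrite /i -[RHS]/((\1_ _ \* \1_ _) w) -indicI.
have i3E (K L N : {RV P >-> bool}) k l n w :
    \1_[set w | [/\ K w = k, L w = l & N w = n]] w = i K k w * i L l w * i N n w.
  rewrite -i2E /i -[RHS]/((\1_ _ \* \1_ _) w) -indicI; congr (\1_ _ _).
  by apply/seteqP; split=> y /= => [[? ? ?]|[[? ?] ?]].

(* Almost sure relations among the potential mediators, [S] and the data *)
have consM : {ae P, forall w a, A w = a -> M w = Mpot a w} by exact: ae_bool.
have consY : {ae P, forall w a m, A w = a -> M w = m -> Y w = Ypot a m w}.
  by apply: ae_bool => a; exact: ae_bool.
have nec : {ae P, forall w b, S w = false -> Mpot b w = false}.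
  apply: ae_bool => b.
  have mD : measurable [set sx : bool * TX | sx.1 = false].
    exact: measurable_fiber.
  have := ae_of_cond_prob0 (mev (Mpot b) true) mD (necessity b).
  by apply: filterS => w /= H /H; case: (Mpot b w).
have suf : {ae P, forall w, S w = true -> Mpot false w = true}.
  have mD : measurable [set sx : bool * TX | sx.1 = true].
    exact: measurable_fiber.
  have := ae_of_cond_prob1 (mev (Mpot false) true) mD sufficiency.
  by apply: filterS => w /=.
(* The principal strata are thereby events in terms of M(1) and S, which
   allows the assumptions made given (X, S) to be used. *)
have SM0 : {ae P, forall w, Mpot false w = S w}.
  apply: filterS2 nec suf => w + sw; move=> /(_ false).
  by case: (S w) sw => [->|_ ->].
have mono : {ae P, forall w, Mpot true w ==> Mpot false w}.
  apply: filterS2 nec SM0 => w /(_ true) + ->.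
  by case: (S w); rewrite ?implybT// => ->.
have iYp a m k : P.-integrable setT
    (EFin \o (fun w => Ypot a m w * i (Mpot a) k w)).
  exact: iM.
have YaE a w : Ya a w =
    Ypot a true w * i (Mpot a) true w + Ypot a false w * i (Mpot a) false w.
  by rewrite /Ya !iE; case: (Mpot a w) => /=; rewrite ?mulr1 ?mulr0 ?addr0 ?add0r.
have iYa a : P.-integrable setT (EFin \o Ya a).
  have := integrableD measurableT (iYp a true true) (iYp a false false).
  by apply: eq_integrable => // w _ /=; rewrite -EFinD -YaE.
(* Integrability is given for the potential outcomes. By consistency [Y] is almost surely the sum
   over (a, m) of [Ypot a m] times the indicator of A = a, M = m. *)
have iY : P.-integrable setT (EFin \o Y).
  pose YA a w :=
    Ypot a true w * i M true w * i A a w + Ypot a false w * i M false w * i A a w.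
  have iYA a : P.-integrable setT (EFin \o YA a).
    have h k : P.-integrable setT
        (EFin \o (fun w => Ypot a k w * i M k w * i A a w)).
      by apply: (iM (fun w => Ypot a k w * i M k w)); exact: iM.
    have := integrableD measurableT (h true) (h false).
    by apply: eq_integrable => // w _.
  have iYY : P.-integrable setT (EFin \o (fun w => YA true w + YA false w)).
    have := integrableD measurableT (iYA true) (iYA false).
    by apply: eq_integrable => // w _.
  apply: integrable_ae_eq iYY => //.
  move: consY; apply: filterS => w /(_ _ _ erefl erefl) ->.
  rewrite /YA !iE; case: (A w); case: (M w) => /=;
  by rewrite ?mulr1 ?mulr0 ?addr0 ?add0r.

(* Regressions given X in terms of potential outcomes *)
have A0 : {ae distribution P X, forall x a, 0 < e (i A a) x} by exact: ae_bool.
pose q a m x := e (i (Mpot a) m) x.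
(* [cond_indep_exp] needs functions of the pair (Y(a,m), M(a)): the ones used are the indicator of
   M(a) = m, and Y(a,m) times that indicator. *)
have msnd (m : bool) : measurable_fun setT
    (fun ym : R * bool => \1_[set y : R * bool | y.2 = m] ym : R).
  by apply: measurable_indic; exact: measurable_fiber.
have mfstsnd (m : bool) : measurable_fun setT
    (fun ym : R * bool => ym.1 * \1_[set y : R * bool | y.2 = m] ym).
  by apply: measurable_funM => //; exact: msnd.
have indF a m : {ae distribution P X, forall x,
    e (fun w => i (Mpot a) m w * i A a w) x = q a m x * e (i A a) x}.
  have := @cond_indep_exp _ _ _ _ _ _ _ _ R P _ _ _ (ignorabilityA a m)
    (\1_[set y : R * bool | y.2 = m]) [set a] _ (msnd m) (ii (Mpot a) m).
  by apply.
have indY a m : {ae distribution P X, forall x,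
    e (fun w => Ypot a m w * i (Mpot a) m w * i A a w) x =
    e (fun w => Ypot a m w * i (Mpot a) m w) x * e (i A a) x}.
  have := @cond_indep_exp _ _ _ _ _ _ _ _ R P _ _ _ (ignorabilityA a m)
    _ [set a] _ (mfstsnd m) (iYp a m m).
  by apply.
have eE Z Z' : P.-integrable setT (EFin \o Z) -> P.-integrable setT (EFin \o Z') ->
    {ae P, forall w, Z w = Z' w} -> e Z = e Z'.
  by move=> iZ iZ'; apply: cond_exp_ae_eq; exact: mI.
have iFA a m : P.-integrable setT (EFin \o (fun w => i (Mpot a) m w * i A a w)).
  exact: iM (ii _ _).
have iYA a m : P.-integrable setT
    (EFin \o (fun w => Ypot a m w * i (Mpot a) m w * i A a w)).
  exact: iM (iYp a m m).
have mJ (K L : {RV P >-> bool}) k l : measurable [set w | K w = k /\ L w = l].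
  by apply: measurableI; exact: mev.
have mJ3 (K L N : {RV P >-> bool}) k l n :
    measurable [set w | [/\ K w = k, L w = l & N w = n]].
  have -> : [set w | [/\ K w = k, L w = l & N w = n]] =
      [set w | K w = k /\ L w = l] `&` [set w | N w = n].
    by apply/seteqP; split=> y /= => [[? ? ?]|[[? ?] ?]].
  exact: measurableI (mJ K L k l) (mev N n).
pose J m a := [set w | M w = m /\ A w = a].
have JE m a : e (\1_(J m a)) = e (fun w => i (Mpot a) m w * i A a w).
  apply: eE => //; first exact: ifun (mJ _ _ _ _).
  move: consM; apply: filterS => w; rewrite i2E !iE.
  by move=> Mw; case: (A w =P a) => [Aa|_]; [rewrite (Mw _ Aa)|rewrite !mulr0].
have YJE m a : e (fun w => Y w * \1_(J m a) w) =
    e (fun w => Ypot a m w * i (Mpot a) m w * i A a w).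
  apply: eE => //; first exact: integrable_mul_indic (mJ _ _ _ _) iY.
  apply: filterS2 consM consY => w; rewrite i2E !iE => Mw Yw.
  case: (A w =P a) => [Aa|]; last by rewrite !mulr0.
  rewrite -(Mw _ Aa); case: (M w =P m) => [Mm|]; last by rewrite ?(mul0r, mulr0).
  by rewrite (Yw _ _ Aa Mm) !mulr1.
(* Multiplied by P(A = a | X = x), both [p] and [q] give P(M(a) = m, A = a | X = x), and this
   positive factor cancels. Positivity of the mediator thus passes to M(a). *)
have G1 : {ae distribution P X, forall x a m, p m a x = q a m x /\ 0 < q a m x}.
  apply: ae_bool => a; apply: ae_bool => m.
  have pE : {ae distribution P X, forall x,
      p m a x * e (i A a) x = e (fun w => i M m w * i A a w) x}.
    exact: (@cond_exp_slice1 _ _ _ _ _ P X A a _ (ii M m)).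
  have JE' : e (fun w => i M m w * i A a w) =
      e (fun w => i (Mpot a) m w * i A a w).
    by rewrite -JE; congr e; apply/funext => w; rewrite i2E.
  apply: filterS4 A0 (positivityM a m) (indF a m) pE => x /(_ a) a0 p0 FE.
  rewrite JE' FE => /(mulIf (lt0r_neq0 a0)) pq.
  by split; [exact: pq|rewrite -pq; exact: p0].
have eJ : {ae distribution P X, forall x a m,
    e (\1_(J m a)) x = q a m x * e (i A a) x}.
  by apply: ae_bool => a; apply: ae_bool => m; rewrite JE; exact: indF.
have eYJ : {ae distribution P X, forall x a m,
    e (fun w => Y w * \1_(J m a) w) x =
    e (fun w => Ypot a m w * i (Mpot a) m w) x * e (i A a) x}.
  by apply: ae_bool => a; apply: ae_bool => m; rewrite YJE; exact: indY.
have G2 : {ae distribution P X, forall x a m,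
    mu m a x * q a m x = e (fun w => Ypot a m w * i (Mpot a) m w) x}.
  apply: ae_bool => a; apply: ae_bool => m.
  have muE : {ae distribution P X, forall x,
      mu m a x * e (\1_(J m a)) x = e (fun w => Y w * \1_(J m a) w) x}.
    exact: (@cond_exp_slice2 _ _ _ _ _ P X M A m a _ iY).
  apply: filterS4 A0 eJ eYJ muE => x /(_ a) a0 /(_ a m) Jx /(_ a m) YJx.
  rewrite YJx Jx mulrA.
  by move/(mulIf (lt0r_neq0 a0)).

(* Principal strata under monotonicity *)
pose St m1 m0 := [set w | Mpot true w = m1 /\ Mpot false w = m0].
have G3 Z : P.-integrable setT (EFin \o Z) ->
    {ae distribution P X, forall x m1 m0,
    Estratum Z m1 m0 x * Pstratum m1 m0 x = e (fun w => Z w * \1_(St m1 m0) w) x}.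
  move=> iZ; apply: ae_bool => m1; apply: ae_bool => m0.
  exact: (@cond_exp_slice2 _ _ _ _ _ P X _ _ m1 m0 _ iZ).
have Ptt x : Pstratum true true x = q true true x.
  congr (_ x); apply: eE; [exact: ifun (mJ _ _ _ _)|exact: ii|].
  move: mono; apply: filterS => w; rewrite i2E !iE.
  by case: (Mpot true w); case: (Mpot false w) => //=; rewrite ?mulr1 ?mulr0.
have Pff x : Pstratum false false x = q false false x.
  congr (_ x); apply: eE; [exact: ifun (mJ _ _ _ _)|exact: ii|].
  move: mono; apply: filterS => w; rewrite i2E !iE.
  by case: (Mpot true w); case: (Mpot false w) => //=; rewrite ?mulr1 ?mulr0.
(* By [mono] the stratum (0,1) is [M(0) = 1] minus its almost sure subset [M(1) = 1], so its
   indicator is a difference of indicators. *)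
have Pft : {ae distribution P X, forall x,
    Pstratum false true x = q false true x - q true true x}.
  have -> : Pstratum false true =
      e (fun w => i (Mpot false) true w - i (Mpot true) true w).
    apply: eE; first exact: ifun (mJ _ _ _ _).
      by have := integrableB measurableT (ii (Mpot false) true)
        (ii (Mpot true) true).
    move: mono; apply: filterS => w; rewrite i2E !iE.
    by case: (Mpot true w); case: (Mpot false w) => //=;
      rewrite ?subrr ?subr0 ?mulr1 ?mulr0.
  exact: cond_expB.
have Stt : e (fun w => Ya true w * \1_(St true true) w) =
    e (fun w => Ypot true true w * i (Mpot true) true w).
  apply: eE; [exact: integrable_mul_indic (mJ _ _ _ _) (iYa _)|exact: iM|].
  move: mono; apply: filterS => w; rewrite i2E /Ya !iE.
  by case: (Mpot true w); case: (Mpot false w) => //=; rewrite ?mulr1 ?mulr0//.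
have Sff : e (fun w => Ya false w * \1_(St false false) w) =
    e (fun w => Ypot false false w * i (Mpot false) false w).
  apply: eE; [exact: integrable_mul_indic (mJ _ _ _ _) (iYa _)|exact: iM|].
  move: mono; apply: filterS => w; rewrite i2E /Ya !iE.
  by case: (Mpot true w); case: (Mpot false w) => //=; rewrite ?mulr1 ?mulr0//.

(* Regressions involving the baseline variable S *)
have S0 : {ae distribution P X, forall x s, 0 < e (i S s) x}.
  apply: ae_bool => s.
  (* Positivity for [S] is inherited from M(0), to which it is almost surely equal. *)
  have <- : e (i (Mpot false) s) = e (i S s).
    by apply: eE => //; move: SM0; apply: filterS => w; rewrite !iE => ->.
  by move: G1; apply: filterS => x /(_ false s) [].
have SA a s : {ae distribution P X, forall x,
    e (fun w => i A a w * i S s w) x = e (i S s) x * e (i A a) x}.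
  have := indepSA [set s] [set a] I I.
  apply: filterS => x /(_ I).
  have -> : e (fun w => i A a w * i S s w) =
      cond_prob P (S @^-1` [set s] `&` A @^-1` [set a]) X.
    by rewrite /cond_prob indicI; congr e; apply/funext => w; rewrite mulrC.
  exact.
(* Contraction of conditional independence: independence given (X, S) factors out P(A = a | X, S =
   s), and [indepSA] identifies this factor with P(A = a | X), whatever [s] is. *)
have indAS a m s (f : R * bool -> R) : measurable_fun setT f ->
    P.-integrable setT (EFin \o (f \o rv_pair (Ypot a m) (Mpot a))) ->
    {ae distribution P X, forall x,
      e (fun w => f (Ypot a m w, Mpot a w) * i A a w * i S s w) x =
      e (fun w => f (Ypot a m w, Mpot a w) * i S s w) x * e (i A a) x}.
  move=> mf ifU.
  have h1 : {ae distribution P (rv_pair X S), forall y,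
      cond_exp P (fun w => f (Ypot a m w, Mpot a w) * i A a w) (rv_pair X S) y =
      cond_exp P (fun w => f (Ypot a m w, Mpot a w)) (rv_pair X S) y *
      cond_exp P (i A a) (rv_pair X S) y}.
    by apply: (@cond_indep_exp _ _ _ _ _ _ _ _ R P _ _ _
      (ignorabilityAS a m) f [set a] _ mf ifU).
  have ifA := iM _ A a ifU.
  have h2 : {ae distribution P X, forall x,
     cond_exp P (fun w => f (Ypot a m w, Mpot a w) * i A a w) (rv_pair X S)
       (x, s) * e (i S s) x =
     e (fun w => f (Ypot a m w, Mpot a w) * i A a w * i S s w) x}.
    exact: (@cond_exp_slicer _ _ _ _ _ P X S s _ ifA).
  have h3 : {ae distribution P X, forall x,
     cond_exp P (fun w => f (Ypot a m w, Mpot a w)) (rv_pair X S) (x, s) *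
       e (i S s) x =
     e (fun w => f (Ypot a m w, Mpot a w) * i S s w) x}.
    exact: (@cond_exp_slicer _ _ _ _ _ P X S s _ ifU).
  have h4 : {ae distribution P X, forall x,
     cond_exp P (i A a) (rv_pair X S) (x, s) * e (i S s) x =
     e (fun w => i A a w * i S s w) x}.
    exact: (@cond_exp_slicer _ _ _ _ _ P X S s _ (ii A a)).
  have h14 := ae_and (ae_slicer s h1) h4.
  apply: filterS5 S0 h14 h2 h3 (SA a s) => x /(_ s) s0 [E1 E4] <- <- E5.
  move: E4; rewrite E5 [RHS]mulrC => /(mulIf (lt0r_neq0 s0)) <-.
  by rewrite (E1 s0) mulrAC.
pose K m a s := [set w | [/\ M w = m, A w = a & S w = s]].
have iMS a m s : P.-integrable setT (EFin \o (fun w => i (Mpot a) m w * i S s w)).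
  exact: iM (ii _ _).
have iYS a m s : P.-integrable setT
    (EFin \o (fun w => Ypot a m w * i (Mpot a) m w * i S s w)).
  exact: iM (iYp a m m).
have iYK m a s := integrable_mul_indic (mJ3 M A S m a s) iY.
have eK : {ae distribution P X, forall x a m s,
    e (\1_(K m a s)) x =
    e (fun w => i (Mpot a) m w * i S s w) x * e (i A a) x}.
  apply: ae_bool => a; apply: ae_bool => m; apply: ae_bool => s.
  have -> : e (\1_(K m a s)) = e (fun w => i (Mpot a) m w * i A a w * i S s w).
    apply: eE; [exact: ifun (mJ3 _ _ _ _ _ _)|exact: iM (iFA a m)|].
    move: consM; apply: filterS => w; rewrite i3E !iE => Mw.
    by case: (A w =P a) => [Aa|_]; [rewrite (Mw _ Aa)|rewrite !mulr0].
  by have := indAS a m s _ (msnd m) (ii (Mpot a) m); apply.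
have eYK : {ae distribution P X, forall x a m s,
    e (fun w => Y w * \1_(K m a s) w) x =
    e (fun w => Ypot a m w * i (Mpot a) m w * i S s w) x * e (i A a) x}.
  apply: ae_bool => a; apply: ae_bool => m; apply: ae_bool => s.
  have -> : e (fun w => Y w * \1_(K m a s) w) =
      e (fun w => Ypot a m w * i (Mpot a) m w * i A a w * i S s w).
    apply: eE; [exact: iYK|exact: iM (iYA a m)|].
    apply: filterS2 consM consY => w; rewrite i3E !iE => Mw Yw.
    case: (A w =P a) => [Aa|]; last by rewrite ?(mul0r, mulr0).
    rewrite -(Mw _ Aa); case: (M w =P m) => [Mm|]; last by rewrite ?(mul0r, mulr0).
    by rewrite (Yw _ _ Aa Mm) !mulr1 mul1r.
  by have := indAS a m s _ (mfstsnd m) (iYp a m m); apply.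
have muSK : {ae distribution P X, forall x a m s,
    muS m a s x * e (\1_(K m a s)) x = e (fun w => Y w * \1_(K m a s) w) x}.
  apply: ae_bool => a; apply: ae_bool => m; apply: ae_bool => s.
  exact: (@cond_exp_slice3 _ _ _ _ _ P X M A S m a s _ iY).
have G4 : {ae distribution P X, forall x a m s,
    muS m a s x * e (fun w => i (Mpot a) m w * i S s w) x =
    e (fun w => Ypot a m w * i (Mpot a) m w * i S s w) x}.
  apply: filterS4 A0 eK eYK muSK => x a0 Kx YKx muSx a m s.
  move: (muSx a m s); rewrite YKx Kx mulrA.
  by move/(mulIf (lt0r_neq0 (a0 a))).
(* Exclusion factors the regression of Y times the indicator of S = s, given (A, M, X), into that of
   Y and that of the indicator. Multiplying by P(A = a, M = m | X) turns this into equality of [muS]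
   and [mu] after multiplication by the probability of [K m a s], which is then cancelled. *)
have G5 : {ae distribution P X, forall x a m s,
    0 < e (fun w => i (Mpot a) m w * i S s w) x -> muS m a s x = mu m a x}.
  apply: ae_bool => a; apply: ae_bool => m; apply: ae_bool => s.
  (* [exclusionS] conditions on A before M, while [mu] has M first. [N] is the regression in the
     former order; it agrees with [mu] because both slices are the same event. *)
  pose J' := [set w | A w = a /\ M w = m].
  have J'E : J' = J m a by apply/seteqP; split=> w [].
  pose N Z x := cond_exp P Z (rv_pair A (rv_pair M X)) (a, (m, x)).
  have NE Z : P.-integrable setT (EFin \o Z) -> {ae distribution P X, forall x,
      N Z x * e (\1_(J m a)) x = e (fun w => Z w * \1_(J m a) w) x}.
    move=> iZ; have := @cond_exp_slice2 _ _ _ _ _ P X A M a m _ iZ.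
    by rewrite -/J' J'E.
  have Nexc : {ae distribution P X, forall x, 0 < e (\1_(J m a)) x ->
      N (fun w => Y w * i S s w) x = N Y x * N (i S s) x}.
    have := @cond_indep_exp _ _ _ _ _ _ _ _ R P _ _ _ exclusionS id [set s] I
      (@measurable_id _ _ _) iY.
    by move=> /(@ae_slice2 _ _ _ _ _ P X A M a m); rewrite -/J' J'E.
  have J0 : {ae distribution P X, forall x, 0 < e (\1_(J m a)) x}.
    apply: filterS3 A0 G1 eJ => x a0 qx ->.
    by rewrite mulr_gt0//; case: (qx a m).
  have h1 := ae_and J0 (ae_and Nexc (NE _ iY)).
  have h2 := ae_and (NE _ (iM _ S s iY)) (NE _ (ii S s)).
  have muE : {ae distribution P X, forall x,
      mu m a x * e (\1_(J m a)) x = e (fun w => Y w * \1_(J m a) w) x}.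
    exact: (@cond_exp_slice2 _ _ _ _ _ P X M A m a _ iY).
  have h3 := ae_and A0 (ae_and eK muSK).
  have KE : (fun w => i S s w * \1_(J m a) w) = \1_(K m a s).
    by apply/funext => w; rewrite i3E i2E mulrC.
  have YKE : (fun w => Y w * i S s w * \1_(J m a) w) =
      (fun w => Y w * \1_(K m a s) w).
    by apply/funext => w; rewrite -KE mulrA.
  move: h1 h2; rewrite KE YKE => h1 h2.
  apply: filterS4 h1 h2 muE h3 => x [Jx [excx N1]] [N2 N3] mux [a0 [Kx muSx]] pos.
  have K0 : 0 < e (\1_(K m a s)) x by rewrite Kx mulr_gt0.
  have -> : mu m a x = N Y x.
    by apply: (mulIf (lt0r_neq0 Jx)); rewrite mux N1.
  apply: (mulIf (lt0r_neq0 K0)); rewrite muSx -N2 excx// -mulrA; congr (_ * _).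
  exact: N3.
have Pfs s x : Pstratum false s x = e (fun w => i (Mpot true) false w * i S s w) x.
  congr (_ x); apply: eE; [exact: ifun (mJ _ _ _ _)|exact: iMS|].
  by move: SM0; apply: filterS => w; rewrite i2E !iE => ->.
have Sfs s : e (fun w => Ya true w * \1_(St false s) w) =
    e (fun w => Ypot true false w * i (Mpot true) false w * i S s w).
  apply: eE; [exact: integrable_mul_indic (mJ _ _ _ _) (iYa _)|exact: iYS|].
  move: SM0; apply: filterS => w; rewrite i2E /Ya !iE => ->.
  by case: (Mpot true w) => /=; rewrite ?(mul0r, mulr0, mul1r, mulr1).
have cancel (x y z : R) : 0 < z -> x * z = y * z -> x = y.
  by move=> /lt0r_neq0 /mulIf; exact.
have Pc : {ae distribution P X, forall x s, 0 < Pstratum false s x ->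
    Estratum (Ya true) false s x = muS false true s x /\
    muS false true s x = mu false true x}.
  apply: filterS3 (G3 _ (iYa true)) G4 G5 => x E4 m4 m5 s; rewrite Pfs => s0.
  split; last exact: m5.
  by apply: cancel s0 _; rewrite m4 -Pfs E4 Sfs.
(* The strata (1,1) and (0,0) have probabilities [q true true x] and [q false false x], positive by
   [G1], so these equalities hold for almost every [x]. *)
have Pb : {ae distribution P X, forall x,
    Estratum (Ya true) true true x = mu true true x /\
    Estratum (Ya false) false false x = mu false false x}.
  apply: filterS4 G1 G2 (G3 _ (iYa true)) (G3 _ (iYa false)) => x q0 m2 E1 E0.
  split.
  - apply: (cancel _ _ (q true true x)); first by case: (q0 true true).
    by rewrite m2 -Ptt E1 Stt.
  - apply: (cancel _ _ (q false false x)); first by case: (q0 false false).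
    by rewrite m2 -Pff E0 Sff.
(* Total expectation of Y(0) over [M(0) = 1], which splits into the strata (0,1) and (1,1); part (d)
   solves this linear equation for the stratum (0,1). *)
have dec : {ae distribution P X, forall x,
    mu true false x * q false true x =
    Estratum (Ya false) false true x * Pstratum false true x +
    Estratum (Ya false) true true x * Pstratum true true x}.
  have iSt m1 m0 := integrable_mul_indic
    (mJ (Mpot true) (Mpot false) m1 m0) (iYa false).
  have EB := cond_expB X (iYp false true true) (iSt true true).
  apply: filterS3 G2 (G3 _ (iYa false)) EB => x -> E0.
  rewrite !E0 -/(St true true) => EBx.
  have -> : e (fun w => Ya false w * \1_(St false true) w) x =
      e (fun w => Ypot false true w * i (Mpot false) true w -
        Ya false w * \1_(St true true) w) x.
    congr (_ x); apply: eE; first exact: iSt.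
      by have := integrableB measurableT (iYp false true true) (iSt true true).
    move: mono; apply: filterS => w; rewrite !i2E /Ya !iE.
    by case: (Mpot true w); case: (Mpot false w) => //=;
      rewrite ?(mul0r, mulr0, mul1r, mulr1) ?subrr ?subr0.
  by rewrite [X in _ = X + _]EBx subrK.
have Pd : {ae distribution P X, forall x, 0 < p true false x - p true true x ->
    Estratum (Ya false) false true x =
    (p true false x * mu true false x -
     p true true x * Estratum (Ya false) true true x) /
    (p true false x - p true true x)}.
  apply: filterS3 G1 dec Pft => x pq decx Pftx.
  have [-> _] := pq false true; have [-> _] := pq true true.
  rewrite -Pftx -Ptt => P0; apply: (mulIf (lt0r_neq0 P0)).
  rewrite divfK ?lt0r_neq0// [q _ _ _ * _]mulrC decx.
  by rewrite [Pstratum true true x * _]mulrC addrK.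
split.
  apply: filterS5 G1 Pft Pb Pc Pd => x pq Pftx [b1 b0] c dx.
  have [ptt _] := pq true true; have [pff _] := pq false false.
  have [pft _] := pq false true.
  split => //; first by rewrite Ptt Pff Pftx ptt pff pft.
  by split; [exact: c|exact: c].

(* Effects under equal means of Y(0,1) and Y(1,1) in the stratum (1,1) *)
move=> hyp.
(* On the stratum (1,1), Y(0) is Y(0,1) and Y(1) is Y(1,1), so [hyp] equates the stratum means of
   Y(0) and Y(1), the latter being known from [Pb]. *)
have eq01 : {ae distribution P X, forall x,
    Estratum (Ya false) true true x = mu true true x}.
  have E01 : e (fun w => Ya false w * \1_(St true true) w) =
      e (fun w => Ypot false true w * \1_(St true true) w).
    apply: eE; [exact: integrable_mul_indic (mJ _ _ _ _) (iYa _)|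
      exact: integrable_mul_indic (mJ _ _ _ _) (Yint _ _)|].
    move: mono; apply: filterS => w; rewrite !i2E /Ya !iE.
    by case: (Mpot true w); case: (Mpot false w) => //=; rewrite ?(mul0r, mulr0).
  have E11 : e (fun w => Ya true w * \1_(St true true) w) =
      e (fun w => Ypot true true w * \1_(St true true) w).
    congr e; apply/funext => w; rewrite !i2E /Ya !iE.
    by case: (Mpot true w) => //=; rewrite ?(mul0r, mulr0).
  have h := ae_and (G3 _ (iYa true)) (G3 _ (Yint true true)).
  have h' := ae_and (G3 _ (iYa false)) (G3 _ (Yint false true)).
  apply: filterS5 G1 Pb hyp h h' => x q0 [<- _] hypx [e1 e2] [e3 e4].
  have P0 : 0 < Pstratum true true x by rewrite Ptt; case: (q0 true true).
  apply: (cancel _ _ _ P0); rewrite e3 E01 -e4 hypx// e2 e1 E11//.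
(* Additivity is almost sure for the law of (M(1), M(0), X); passing to the law of X requires the
   stratum to have positive probability. *)
have tauE : {ae distribution P X, forall x m1 m0, 0 < Pstratum m1 m0 x ->
    tau m1 m0 x = Estratum (Ya true) m1 m0 x - Estratum (Ya false) m1 m0 x}.
  apply: ae_bool => m1; apply: ae_bool => m0.
  exact: (@ae_slice2 _ _ _ _ _ P X _ _ m1 m0 _
    (cond_expB _ (iYa true) (iYa false))).
have h := ae_and G1 Pft.
apply: filterS4 h (ae_and Pb Pc) (ae_and Pd eq01) tauE =>
  x [pq Pftx] [[b1 b0] c] [dx e01] taux.
split.
- by [].
- by move=> P0; rewrite taux// b1 e01 subrr.
- by move=> P0; rewrite taux// b0; have [-> ->] := c false P0.
- move=> p0; have P0 : 0 < Pstratum false true x.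
    rewrite Pftx; have [<- _] := pq false true; have [<- _] := pq true true.
    exact: p0.
  by rewrite taux// dx// e01; have [-> ->] := c true P0.
Qed.
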